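(* Let $L$ be a compactly generated multiplicative lattice in which the top element $1$ is compact and every finite product of compact elements is compact. If $L$ is $z$-Noetherian, then the set of minimal $z$-prime elements of $L$ (the minimal elements, with respect to $\leqslant$, of the set of $z$-prime elements of $L$) is finite.
   Context: A multiplicative lattice is a complete lattice $(L,\leqslant,0,1)$ endowed with an associative, commutative multiplication which distributes over arbitrary joins and has $1$ as multiplicative identity. An element $c\in L$ is compact if for any $\{x_\lambda\}_{\lambda\in\Lambda}\subseteq L$, $c\leqslant\bigvee_{\lambda\in\Lambda}x_\lambda$ implies $c\leqslant\bigvee_{i=1}^n x_{\lambda_i}$ for some $n\in\mathbb{N}^+$ and $\lambda_1,\dots,\lambda_n\in\Lambda$; $L$ is compactly generated if every element of $L$ is a join of compact elements. An element $x$ is proper if $x\neq 1$. A proper element $m$ is maximal if $m\leqslant x$ and $x<1$ imply $m=x$, for all $x\in L$; $\mathcal{M}(L)$ is the set of maximal elements. For $a\in L$ put $\mathcal{M}_a=\{m\in\mathcal{M}(L)\mid a\leqslant m\}$. An element $x\in L$ is a $z$-element if for all $a,b\in L$, $\mathcal{M}_a=\mathcal{M}_b$ and $b\leqslant x$ imply $a\leqslant x$. $L$ is $z$-Noetherian if every ascending chain of $z$-elements in $L$ is eventually stationary. A proper $z$-element $p$ is $z$-prime if for all $z$-elements $a,b$ of $L$, $ab\leqslant p$ implies $a\leqslant p$ or $b\leqslant p$. *)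

(* Defs.v *)
From HB Require Import structures.
From mathcomp Require Import all_boot all_order.
From mathcomp Require Import boolp classical_sets functions cardinality.

Set Implicit Arguments.
Unset Strict Implicit.
Unset Printing Implicit Defensive.

Import Order.TTheory.
Local Open Scope classical_set_scope.
Local Open Scope order_scope.

HB.mixin Record TBLattice_isComplete d (L : Type) of Order.TBLattice d L := {
  bigjoin : set L -> L;
  bigjoin_supremums : forall A : set L, supremums A (bigjoin A)
}.

#[short(type="completeLatticeType")]
HB.structure Definition CompleteLattice d :=
  { L of Order.TBLattice d L & TBLattice_isComplete d L }.

(* The distributive law covers A = set0, where it says x * \bot = \bot. *)
HB.mixin Record CompleteLattice_isMultiplicative d (L : Type)
    of CompleteLattice d L := {
  lmul : L -> L -> L;
  lmulA : associative lmul;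
  lmulC : commutative lmul;
  lmul1x : left_id \top lmul;
  lmul_bigjoinr : forall (x : L) (A : set L),
    lmul x (bigjoin A) = bigjoin [set lmul x y | y in A]
}.

#[short(type="multLatticeType")]
HB.structure Definition MultLattice d :=
  { L of CompleteLattice d L & CompleteLattice_isMultiplicative d L }.

HB.instance Definition _ d (L : multLatticeType d) :=
  Monoid.isComLaw.Build L \top lmul lmulA lmulC lmul1x.

Section MultLatticeTheory.
Context {d : Order.disp_t} {L : multLatticeType d}.
Implicit Types (a b c m p x : L).

(* The family is required to be nonempty: for the empty one, whose join is
   \bot, there is no finite subfamily with n >= 1 members, and \bot would
   fail to be compact. *)
Definition lcompact c : Prop :=
  forall A : set L, A !=set0 -> c <= bigjoin A ->
    exists (n : nat) (x : 'I_n.+1 -> L),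
      (forall i, A (x i)) /\ c <= \join_(i < n.+1) x i.

Definition proper_elt x : Prop := x <> \top.

Definition maximal_elt m : Prop :=
  proper_elt m /\ forall x, m <= x -> x < \top -> m = x.

Definition maximals_above a : set L := [set m | maximal_elt m /\ a <= m].

Definition z_element x : Prop :=
  forall a b, maximals_above a = maximals_above b -> b <= x -> a <= x.

Definition z_prime p : Prop :=
  [/\ proper_elt p, z_element p &
    forall a b, z_element a -> z_element b ->
      lmul a b <= p -> a <= p \/ b <= p].

End MultLatticeTheory.

Definition compactly_generated d (L : multLatticeType d) : Prop :=
  forall x : L, exists2 A : set L, A `<=` lcompact & x = bigjoin A.

Definition z_Noetherian d (L : multLatticeType d) : Prop :=
  forall u : nat -> L, (forall n, z_element (u n)) ->
    (forall n, u n <= u n.+1) ->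
    exists N : nat, forall n : nat, (N <= n)%N -> u n = u N.

Definition minimal_z_primes d (L : multLatticeType d) : set L :=
  [set p | z_prime p /\ forall q : L, z_prime q -> q <= p -> q = p].

Arguments minimal_z_primes {d} L _.

(* Main.v *)
(** Write [z a] for the least z-element above [a].  Maximal elements are
    z-elements and are prime, so [maximals_above (z a * z b)] equals
    [maximals_above (a * b)], whence a z-element lying above [a * b] lies above
    [z a * z b].  Noetherian induction on z-elements then shows that every
    z-element [x] lies above a finite product of z-primes: if [x] is proper and
    not z-prime, say [a * b <= x] with neither factor below [x], the induction
    hypothesis applies to [z (a \/ x)] and [z (b \/ x)], whose product is below
    [x].  Taking [x = z 0], every z-prime lies above one of finitely many
    z-primes. *)
Require Import Defs.
From HB Require Import structures.
From mathcomp Require Import all_boot all_order.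
From mathcomp Require Import boolp classical_sets functions cardinality.

Set Implicit Arguments.
Unset Strict Implicit.
Unset Printing Implicit Defensive.

Import Order.TTheory.
Local Open Scope classical_set_scope.
Local Open Scope order_scope.

Section MultLattice.
Context {d : Order.disp_t} {L : multLatticeType d}.
Implicit Types (a b c m p x y : L) (A : set L) (s : seq L).

Lemma bigjoin_ub A x : A x -> x <= bigjoin A.
Proof. by move=> Ax; have [ubA _] := bigjoin_supremums A; apply: ubA. Qed.

Lemma bigjoin_le A y : (forall x, A x -> x <= y) -> bigjoin A <= y.
Proof. by move=> Ay; have [_ lubA] := bigjoin_supremums A; apply: lubA. Qed.

Lemma bigjoin2 a b : bigjoin [set a; b] = a `|` b.
Proof.
apply/le_anti/andP; split.
  by apply: bigjoin_le => x [->|->]; rewrite ?leUl ?leUr.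
by rewrite leUx !bigjoin_ub //; [right|left].
Qed.

Lemma lmulUr x a b : lmul x (a `|` b) = lmul x a `|` lmul x b.
Proof. by rewrite -bigjoin2 lmul_bigjoinr image_setU !image_set1 bigjoin2. Qed.

Lemma lmulUl x a b : lmul (a `|` b) x = lmul a x `|` lmul b x.
Proof. by rewrite lmulC lmulUr !(lmulC x). Qed.

Lemma lmul_le2l x a b : a <= b -> lmul x a <= lmul x b.
Proof. by move=> /join_idPr <-; rewrite lmulUr leUl. Qed.

Lemma lmul_le2 a b x y : a <= x -> b <= y -> lmul a b <= lmul x y.
Proof.
move=> leax leby; apply: le_trans (lmul_le2l a leby) _.
by rewrite !(lmulC _ y) lmul_le2l.
Qed.

Lemma lmul_lel a b : lmul a b <= a.
Proof. by rewrite -[leRHS](Monoid.mulm1 lmul) lmul_le2l ?lex1. Qed.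

Lemma lmul_ler a b : lmul a b <= b.
Proof. by rewrite lmulC lmul_lel. Qed.

(** If [a] is not below [m], then [a] and [m] join to [\top], so [b] is the join of [lmul a b] and
    [lmul m b], both below [m]. *)
Lemma maximal_prime m a b :
  maximal_elt m -> lmul a b <= m -> a <= m \/ b <= m.
Proof.
move=> [_ max_m] leabm.
case: (boolP (a <= m)) => [|nleam]; [by left | right].
have am1 : a `|` m = \top.
  apply/eqP; apply: contraNT nleam => amN1.
  by rewrite (max_m (a `|` m)) ?leUr ?leUl // lt_neqAle amN1 lex1.
by rewrite -[b]lmul1x -am1 lmulUl leUx leabm lmul_lel.
Qed.

Lemma maximals_above_mul a b :
  maximals_above (lmul a b) = (maximals_above a `|` maximals_above b)%classic.
Proof.
apply/seteqP; split=> [m [max_m /(maximal_prime max_m)[]]|m [] [max_m lem]].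
- by left.
- by right.
- by split=> //; apply: le_trans lem; apply: lmul_lel.
- by split=> //; apply: le_trans lem; apply: lmul_ler.
Qed.

(** The meet of all z-elements above [a], written as the join of their lower bounds because the
    structure carries [bigjoin]. *)
Definition z_closure a : L :=
  bigjoin [set y | forall x, z_element x -> a <= x -> y <= x].

Lemma z_closure_min a x : z_element x -> a <= x -> z_closure a <= x.
Proof. by move=> zx leax; apply: bigjoin_le => y; apply. Qed.

Lemma le_z_closure a : a <= z_closure a.
Proof. by apply: bigjoin_ub => x _. Qed.

Lemma z_closure_z a : z_element (z_closure a).
Proof.
move=> b c eq_bc lec; apply: bigjoin_ub => x zx leax.
apply: (zx _ _ eq_bc); exact: le_trans lec (z_closure_min zx leax).
Qed.

Lemma maximal_z m : maximal_elt m -> z_element m.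
Proof.
move=> max_m a b eq_ab lebm.
have : maximals_above b m by [].
by rewrite -eq_ab => -[].
Qed.

Lemma maximals_above_z_closure a :
  maximals_above (z_closure a) = maximals_above a.
Proof.
apply/seteqP; split=> m [max_m lem]; split=> //.
  exact: le_trans (le_z_closure a) lem.
by apply: z_closure_min => //; apply: maximal_z.
Qed.

(** Both products lie below the same maximal elements. This lets the primality condition, stated for
    z-elements only, be applied to arbitrary factors. *)
Lemma z_closure_mul_le a b x :
  z_element x -> lmul a b <= x -> lmul (z_closure a) (z_closure b) <= x.
Proof.
by move=> zx; apply: zx; rewrite !maximals_above_mul !maximals_above_z_closure.
Qed.

Lemma z_Noetherian_ind (P : L -> Prop) : z_Noetherian L ->
  (forall x, z_element x ->
     (forall y, z_element y -> x < y -> P y) -> P x) ->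
  forall x, z_element x -> P x.
Proof.
move=> noeth indP x zx; apply: contrapT => nPx.
pose bad y := z_element y /\ ~ P y.
(* Keeping [bad y] inside the existential makes the relation total, as [choice] requires; a [y] that
   is not bad is sent to itself. Iterating from [x] gives a strictly ascending chain. *)
have step y : exists y', bad y -> bad y' /\ y < y'.
  have [[zy nPy]|nbad] := pselect (bad y); last by exists y.
  apply: contrapT => no_y'; apply: nPy; apply: indP => // y' zy' lty.
  by apply: contrapT => nPy'; apply: no_y'; exists y'.
have [f fP] := choice step.
have badf n : bad (iter n f x) by elim: n => //= n /fP[].
have ltf n : iter n f x < iter n.+1 f x by have /fP[] := badf n.
have [N eqN] := noeth (fun n => iter n f x) (fun n => (badf n).1)
  (fun n => ltW (ltf n)).
by have := ltf N; rewrite (eqN N.+1) ?ltxx.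
Qed.

Lemma z_element_above_z_primes x : z_Noetherian L -> z_element x ->
  exists2 s, (forall p, p \in s -> z_prime p) &
    \big[lmul / \top]_(p <- s) p <= x.
Proof.
move=> noeth; move: x; apply: z_Noetherian_ind => // x zx IH.
(* The empty product is [\top]. *)
have [->|x_proper] := pselect (x = \top); first by exists [::]; rewrite ?lex1.
have [zpx|nzpx] := pselect (z_prime x).
  by exists [:: x]; rewrite ?big_seq1 // => p; rewrite inE => /eqP ->.
have [a [b [leab nlea nleb]]] :
    exists a b, [/\ lmul a b <= x, ~ a <= x & ~ b <= x].
  apply: contrapT => no_ab; apply: nzpx; split=> // a b _ _ leab.
  apply: contrapT => /not_orP[nlea nleb].
  by apply: no_ab; exists a, b.
(* Joining with [x] puts the closure strictly above [x], where the induction hypothesis applies. *)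
have above c : ~ c <= x -> exists2 s, (forall p, p \in s -> z_prime p) &
    \big[lmul / \top]_(p <- s) p <= z_closure (c `|` x).
  move=> nlec; apply: IH; first exact: z_closure_z.
  apply: lt_le_trans (le_z_closure _).
  by rewrite lt_neqAle leUr andbT eq_sym eq_joinr; apply/negP.
have [sa zsa lea] := above a nlea; have [sb zsb leb] := above b nleb.
exists (sa ++ sb) => [p|].
  by rewrite mem_cat => /orP[/zsa|/zsb].
rewrite big_cat /=; apply: le_trans (lmul_le2 lea leb) _.
apply: z_closure_mul_le => //.
(* On expanding, every term except [lmul a b] has [x] as a factor. *)
by rewrite lmulUr !lmulUl !leUx leab !lmul_lel !lmul_ler.
Qed.

Lemma z_prime_above_factor p s : z_prime p ->
  \big[lmul / \top]_(q <- s) q <= p -> exists2 q, q \in s & q <= p.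
Proof.
move=> [p_proper zp primep]; elim: s => [|q s IH].
  (* The empty product would force [p] to be [\top]. *)
  by rewrite big_nil le1x => /eqP /p_proper.
rewrite big_cons => /(z_closure_mul_le zp).
case/(primep _ _ (@z_closure_z _) (@z_closure_z _)) => lep.
  by exists q; rewrite ?mem_head //; apply: le_trans (le_z_closure q) lep.
have [|r rs lerp] := IH; first exact: le_trans (le_z_closure _) lep.
by exists r; rewrite ?in_cons ?rs ?orbT.
Qed.

End MultLattice.

Theorem proposition5p8 (d : Order.disp_t) (L : multLatticeType d)
    (L_compactly_generated : compactly_generated L)
    (top_compact : lcompact (\top : L))
    (prod_compact : forall s : seq L, (forall c : L, c \in s -> lcompact c) ->
       lcompact (\big[lmul / \top]_(c <- s) c))
    (L_zNoetherian : z_Noetherian L) :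
  finite_set (minimal_z_primes L).
Proof.
have [s zs les] :=
  z_element_above_z_primes L_zNoetherian (@z_closure_z _ _ \bot).
(* A minimal [p] above a z-prime [q] of [s] equals [q], so the minimal z-primes all occur in [s]. *)
apply: sub_finite_set (finite_seq s) => p [zp minp].
have [|q qs leqp] := @z_prime_above_factor _ _ p s zp.
  by apply: le_trans les _; apply: z_closure_min; [case: zp | exact: le0x].
by rewrite /= -(minp q (zs q qs) leqp).
Qed.
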